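(* Let $S$ be a finite nonempty set, let $1\le k<n$ be integers, and let $\mathcal{M}\subseteq\mathbb{R}^{S^n}$ be the $k$-th order homogeneous multistate Markov chain model on $S$ for paths of length $n$. Fix two states $\psi,\eta\in S$ and two blocks of states $\Gamma=(\gamma_1,\ldots,\gamma_k)$ and $\Delta=(\delta_1,\ldots,\delta_k)$ of length $k$ (occupying consecutive positions in a path). Then the vanishing ideal $I(\mathcal{M})$ contains all binomials of the form $$p_{I,\Gamma,\psi,\Delta,J}\;p_{I',\Gamma,\eta,\Delta,J'}-p_{I,\Gamma,\eta,\Delta,J}\;p_{I',\Gamma,\psi,\Delta,J'},$$ where $I,I',J,J'$ are index blocks such that the concatenations $I\,\Gamma\,\psi\,\Delta\,J$, $I'\,\Gamma\,\psi\,\Delta\,J'$, $I\,\Gamma\,\eta\,\Delta\,J$ and $I'\,\Gamma\,\eta\,\Delta\,J'$ define paths of length $n$. If one of the blocks $I$ or $I'$ is empty (respectively, $J$ or $J'$ is empty), then the corresponding block $\Gamma$ (respectively, $\Delta$) may have length strictly smaller than $k$.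
   Context: The homogeneous $k$-th order model: parameters are real numbers $\pi_{i_1\ldots i_k}$ (for $(i_1,\dots,i_k)\in S^k$) and $a_{i_0i_1\cdots i_k}$ (for $(i_0,\dots,i_k)\in S^{k+1}$, not depending on time), and $$\phi_{i_1\ldots i_n}(\pi,a)=\pi_{i_1\ldots i_k}\prod_{\ell=k+1}^n a_{i_{\ell-k}\cdots i_{\ell-1}i_\ell},\qquad (i_1,\dots,i_n)\in S^n.$$ $\Theta$ is the set of $(\pi,a)$ with all entries nonnegative, $\sum_{i_1,\dots,i_k\in S}\pi_{i_1\ldots i_k}=1$, and $\sum_{i_k\in S}a_{i_0\cdots i_{k-1}i_k}=1$ for all $i_0,\dots,i_{k-1}\in S$; and $\mathcal{M}=\phi(\Theta)$. $I(\mathcal{M})$ is the ideal of all polynomials in $\mathbb{R}[p_{i_1\ldots i_n}\mid(i_1,\dots,i_n)\in S^n]$ vanishing on $\mathcal{M}$. An index block is a finite (possibly empty) sequence of states, a path of length $n$ is an element of $S^n$, and $p_{I,\Gamma,\psi,\Delta,J}$ denotes the variable indexed by the concatenated path.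
   Formalization: Γ may be shorter than k only when both I and I' are empty, and Δ only when both J and J' are empty; with just one of the two blocks empty the claim fails (e.g. k=1, n=3, Γ and I empty, I'=(i), Δ=(d), J=(j), J' empty). *)

(* Defs.v *)
From mathcomp Require Import all_boot all_order all_algebra.
From mathcomp Require Import classical_sets reals.
From mathcomp Require Import mpoly.

Set Implicit Arguments.
Unset Strict Implicit.
Unset Printing Implicit Defensive.

Import GRing.Theory Num.Theory.

Local Open Scope ring_scope.
Local Open Scope classical_set_scope.

Section Paths.
Context (S : finType) (k n : nat).

Definition initial_block (hkn : (k < n)%N) (s : n.-tuple S) : k.-tuple S :=
  [tuple tnth s (widen_ord (ltnW hkn) i) | i < k].

Lemma window_subproof (j : 'I_(n - k)) (i : 'I_k.+1) : (j + i < n)%N.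
Proof.
have : (k + j < n)%N by rewrite -ltn_subRL.
by apply: leq_ltn_trans; rewrite addnC leq_add2r -ltnS.
Qed.

(* With 0-based positions, [window s j] lists the entries j, ..., j + k of the
   path s; the 1-based index l = k+1, ..., n of the last entry is j + k + 1. *)
Definition window (s : n.-tuple S) (j : 'I_(n - k)) : k.+1.-tuple S :=
  [tuple tnth s (Ordinal (window_subproof j i)) | i < k.+1].

End Paths.

Section Model.
Context (R : realType) (S : finType) (k n : nat).

Notation params := ({ffun k.-tuple S -> R} * {ffun k.+1.-tuple S -> R})%type.

Definition Theta : set params := [set theta : params |
  [/\ (forall i, 0 <= theta.1 i),
      (forall i, 0 <= theta.2 i),
      \sum_(i : k.-tuple S) theta.1 i = 1
    & forall i : k.-tuple S, \sum_(j : S) theta.2 [tuple of rcons i j] = 1]].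

Definition phi (hkn : (k < n)%N) (theta : params) : {ffun n.-tuple S -> R} :=
  [ffun s => theta.1 (initial_block hkn s)
             * \prod_(j < n - k) theta.2 (window s j)].

Definition markov_model (hkn : (k < n)%N) : set {ffun n.-tuple S -> R} :=
  phi hkn @` Theta.

End Model.

Section VanishingIdeal.
Context (R : realType) (T : finType).

(* R[p_t | t in T] is encoded as {mpoly R[#|T|]}, the variable p_t being the
   one numbered by the rank of t in the enumeration of T. *)
Definition pvar (t : T) : {mpoly R[#|T|]} := 'X_(enum_rank t).

Definition eval_at (x : {ffun T -> R}) (f : {mpoly R[#|T|]}) : R :=
  f.@[fun i => x (enum_val i)].

Definition vanishing_ideal (M : set {ffun T -> R}) : set {mpoly R[#|T|]} :=
  [set f | forall x, M x -> eval_at x f = 0].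

End VanishingIdeal.

Arguments pvar R {T} t.

(* Main.v *)
(* If C is a block of length k, the window product of A C B factors as that of
   A C times that of C B, because no window of length k+1 meeting A can reach
   B. Cutting each of the four paths at those of Gamma, Delta that have length
   k isolates the factor involving psi or eta, and the resulting products
   agree up to reordering. If both Gamma and Delta are shorter than k, then all
   outer blocks are empty, so s1 = s4 and s2 = s3. *)
Require Import Defs.
From mathcomp Require Import all_boot all_order all_algebra.
From mathcomp Require Import classical_sets reals.
From mathcomp Require Import mpoly.
From mathcomp Require Import ring.

Set Implicit Arguments.
Unset Strict Implicit.
Unset Printing Implicit Defensive.

Import GRing.Theory Num.Theory.

Local Open Scope ring_scope.
Local Open Scope classical_set_scope.

Section WeightsOnSequences.
Context (R : comPzRingType) (S : finType) (k : nat).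
Context (pi : {ffun k.-tuple S -> R}) (a : {ffun k.+1.-tuple S -> R}).
Implicit Types A B C u : seq S.

(* The default value 1 makes incomplete windows at the end of a sequence
   harmless. *)
Definition seq_weight m (f : {ffun m.-tuple S -> R}) u : R :=
  oapp f 1 (insub u : option (m.-tuple S)).

Lemma seq_weight_tuple m (f : {ffun m.-tuple S -> R}) (t : m.-tuple S) :
  seq_weight f t = f t.
Proof. by rewrite /seq_weight valK. Qed.

Lemma seq_weight_default m (f : {ffun m.-tuple S -> R}) u :
  size u != m -> seq_weight f u = 1.
Proof. by move=> ?; rewrite /seq_weight insubN. Qed.

(** Every position of [u] starts a window, complete or not, so the recursion on a cons needs no
    condition on the length. *)
Definition window_prod u : R :=
  \prod_(j < size u) seq_weight a (take k.+1 (drop j u)).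

Definition path_weight u : R := seq_weight pi (take k u) * window_prod u.

Lemma window_prod_cons x u :
  window_prod (x :: u) = seq_weight a (take k.+1 (x :: u)) * window_prod u.
Proof. by rewrite /window_prod big_ord_recl. Qed.

Lemma window_prod_short u : (size u <= k)%N -> window_prod u = 1.
Proof.
move=> le_uk; rewrite /window_prod big1 // => j _.
rewrite seq_weight_default // neq_ltn size_take_min size_drop ltnS geq_min.
by rewrite (leq_trans (leq_subr _ _) le_uk) orbT.
Qed.

Lemma window_prod_cat A C B : size C = k ->
  window_prod (A ++ C ++ B) = window_prod (A ++ C) * window_prod (C ++ B).
Proof.
move=> szC; elim: A => [|x A IHA].
  by rewrite /= (@window_prod_short C) ?szC ?mul1r.
rewrite !cat_cons !window_prod_cons IHA mulrA; congr (_ * _ * _).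
(* The window starting at [x] has [k.+1] entries; since [C] has length [k], it ends within
   [x :: A ++ C] and never sees [B]. *)
congr seq_weight; rewrite catA -!cat_cons takel_cat //=.
by rewrite size_cat szC ltnS leq_addl.
Qed.

(** The initial factor goes to the left piece, as [A ++ C] already contains the first [k]
    entries. *)
Lemma path_weight_cat A C B : size C = k ->
  path_weight (A ++ C ++ B) = path_weight (A ++ C) * window_prod (C ++ B).
Proof.
move=> szC; rewrite /path_weight window_prod_cat // mulrA.
by rewrite catA takel_cat // size_cat szC leq_addl.
Qed.

End WeightsOnSequences.

Lemma initial_block_take (S : finType) (k n : nat) (hkn : (k < n)%N)
    (s : n.-tuple S) :
  initial_block hkn s = take k s :> seq S.
Proof.
have lekn := ltnW hkn.
have x0 := tnth s (Ordinal hkn).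
apply: (@eq_from_nth _ x0) => [|i].
  by rewrite size_tuple size_takel ?size_tuple.
rewrite size_tuple => lt_ik; rewrite nth_take //.
by rewrite -[i]/(val (Ordinal lt_ik)) -tnth_nth tnth_mktuple (tnth_nth x0).
Qed.

Lemma window_take_drop (S : finType) (k n : nat) (s : n.-tuple S)
    (j : 'I_(n - k)) :
  window s j = take k.+1 (drop j s) :> seq S.
Proof.
have lt_jkn : (j + k < n)%N by rewrite addnC -ltn_subRL.
have x0 := tnth s (Ordinal lt_jkn).
apply: (@eq_from_nth _ x0) => [|i].
  by rewrite size_tuple size_takel // size_drop size_tuple ltn_subRL.
rewrite size_tuple => lt_ik; rewrite nth_take // nth_drop.
by rewrite -[i]/(val (Ordinal lt_ik)) -tnth_nth tnth_mktuple (tnth_nth x0).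
Qed.

(** Passes from tuples to plain sequences, where a path can be cut into pieces of any length. *)
Lemma phi_path_weight (R : realType) (S : finType) (k n : nat)
    (hkn : (k < n)%N)
    (theta : {ffun k.-tuple S -> R} * {ffun k.+1.-tuple S -> R})
    (s : n.-tuple S) :
  phi hkn theta s = path_weight theta.1 theta.2 s.
Proof.
rewrite ffunE /path_weight /window_prod -(initial_block_take hkn).
rewrite seq_weight_tuple size_tuple; congr (_ * _).
rewrite -(big_mkord xpredT
  (fun j => seq_weight theta.2 (take k.+1 (drop j s)))).
(* Starts [j] below [n - k] give the factors of [phi]; from [n - k] on, at most [k] entries remain
   and the factor is 1. *)
rewrite (big_cat_nat (n := n - k)) ?leq_subr //= big_mkord.
rewrite [X in _ * X]big_nat [X in _ * X]big1 ?mulr1 => [|j /andP[le_j _]].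
  by apply: eq_bigr => j _; rewrite -window_take_drop seq_weight_tuple.
rewrite seq_weight_default // neq_ltn size_take_min size_drop size_tuple.
by rewrite ltnS geq_min leq_subLR addnC -leq_subLR le_j orbT.
Qed.

Theorem proposition5p2 (R : realType) (S : finType) (hS : (0 < #|S|)%N)
    (k n : nat) (hk : (1 <= k)%N) (hkn : (k < n)%N)
    (psi eta : S) (Gamma Delta I I' J J' : seq S)
    (hGamma : size Gamma = k \/ [/\ (size Gamma < k)%N, I = [::] & I' = [::]])
    (hDelta : size Delta = k \/ [/\ (size Delta < k)%N, J = [::] & J' = [::]])
    (s1 s2 s3 s4 : n.-tuple S)
    (hs1 : s1 = I ++ Gamma ++ psi :: Delta ++ J :> seq S)
    (hs2 : s2 = I' ++ Gamma ++ eta :: Delta ++ J' :> seq S)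
    (hs3 : s3 = I ++ Gamma ++ eta :: Delta ++ J :> seq S)
    (hs4 : s4 = I' ++ Gamma ++ psi :: Delta ++ J' :> seq S) :
  vanishing_ideal (@markov_model R S k n hkn)
    (pvar R s1 * pvar R s2 - pvar R s3 * pvar R s4).
Proof.
move=> _ [theta _ <-].
rewrite /eval_at /pvar mevalB !mevalM !mevalXU !enum_rankK !phi_path_weight.
rewrite hs1 hs2 hs3 hs4; apply/eqP; rewrite subr_eq0; apply/eqP.
case: hGamma => [szG|[_ -> ->]].
  rewrite !(path_weight_cat _ _ _ _ szG).
  case: hDelta => [szD|[_ -> ->]]; last by rewrite !cats0; ring.
  (* The part to the right of [Gamma] is cut again at [Delta], separating [J] and [J'] from the
     middle state. *)
  rewrite -!cat_rcons !catA -!(catA _ Delta) !(window_prod_cat _ _ _ szD).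
  ring.
case: hDelta => [szD|[_ -> ->]]; last exact: mulrC.
(* With [I] and [I'] empty, the only cut is at [Delta], and the initial factor stays with the piece
   containing [psi] or [eta]. *)
rewrite !cat0s -!cat_rcons !catA -!(catA _ Delta) !(path_weight_cat _ _ _ _ szD).
ring.
Qed.
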